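(* Let $n\ge 2$ and $\epsilon\in[0,1]$. Let $\Omega\subset\partial_\infty\mathbb H^n\times\mathbb R$ be a bounded $C^0$ domain with boundary $\Gamma$, and let $f\in C^0(\Gamma)$ be a positive function. Assume that $f$ admits a positive extension $g\in C^2(\Omega)\cap C^0(\overline\Omega)$ satisfying the $\epsilon$-horizontal minimal equation $\mathcal M_\epsilon(g)=0$ in $\Omega$. Then $$\min_\Gamma f< g< R(\Omega,f)\quad\text{in }\Omega .$$
   Context: Upper half-space model: $\mathbb H^n=\{(x_1,\dots,x_{n-1},y): y>0\}$, and $\partial_\infty\mathbb H^n\times\mathbb R$ is identified with $\mathbb R^{n-1}\times\mathbb R=\mathbb R^n$ with coordinates $(x_1,\dots,x_{n-1},t)$ and the Euclidean metric. For a positive $C^2$ function $g=g(x_1,\dots,x_{n-1},t)$ and $\epsilon\in[0,1]$ set $$\mathcal M_\epsilon(g)=\sum_{k=1}^{n-1}\Big[g^2\Big(1+\sum_{j\ne k,\,1\le j\le n-1}g_{x_j}^2\Big)+g_t^2+\tfrac{\epsilon}{n-1}\Big]g_{x_kx_k}+\Big(1+\sum_{k=1}^{n-1}g_{x_k}^2\Big)g_{tt}-2\sum_{k=1}^{n-1}g_{x_k}g_tg_{x_kt}-2g^2\sum_{1\le j<k\le n-1}g_{x_j}g_{x_k}g_{x_jx_k}+(n-1)g\Big(1+\sum_{k=1}^{n-1}g_{x_k}^2\Big)+(n-2)\frac{g_t^2}{g}.$$ The equation $\mathcal M_\epsilon(g)=0$ is the $\epsilon$-horizontal minimal equation. Definition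 of $R(\Omega,f)$: - If $n=2$ (coordinates $(x,t)$), let $h(\Gamma)=\max_\Gamma x-\min_\Gamma x$ and $R(\Omega,f)=\sqrt{\max_\Gamma f^2+(h(\Gamma)/2)^2}$. - If $n\ge3$, let $\Omega^\pi$ be the orthogonal projection of $\Omega$ on $\partial_\infty\mathbb H^n\times\{0\}$ (the hyperplane $t=0$, i.e. $\mathbb R^{n-1}$), let $r(\Omega)$ be the radius of the smallest closed round $(n-1)$-disk containing $\Omega^\pi$ with center in $\Omega^\pi$, and $R(\Omega,f)=\sqrt{\max_\Gamma f^2+r^2(\Omega)}$. *)

(* Defs.v *)
From HB Require Import structures.
From mathcomp Require Import all_boot all_order all_algebra.
From mathcomp Require Import all_classical all_reals all_analysis.

Set Implicit Arguments.
Unset Strict Implicit.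
Unset Printing Implicit Defensive.

Import Order.TTheory GRing.Theory Num.Theory.
Import numFieldNormedType.Exports.

Local Open Scope classical_set_scope.
Local Open Scope ring_scope.

(* R^n = R^(n-1) x R with coordinates (x_1, ..., x_(n-1), t); intended for
   1 <= n. The norm is the library's sup norm, which induces the Euclidean
   topology; the Euclidean metric itself is [edist]. *)
Notation pt R n := ('rV[R]_n.-1 * R)%type.

Section HorizontalMinimalEquation.
Context {R : realType} {n : nat}.
Implicit Types (z : pt R n) (g f : pt R n -> R) (D Om : set (pt R n)).

Definition ex (k : 'I_n.-1) : pt R n := (delta_mx 0 k, 0).
Definition et : pt R n := (0, 1).

(* [Some k] is the direction x_k and [None] the direction t. *)
Definition axis (i : option 'I_n.-1) : pt R n := if i is Some k then ex k else et.

(* C^k regularity on an open set D. The values of g outside D are irrelevant,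
   since D is open and every condition is imposed at points of D only. *)
Fixpoint Ck (k : nat) D g : Prop :=
  (forall z, D z -> {for z, continuous g}) /\
  (if k is k'.+1 then
     forall i, (forall z, D z -> derivable g z (axis i)) /\
               Ck k' D ('D_(axis i) g)
   else True).

Definition hminop (eps : R) g z : R :=
  let gx (k : 'I_n.-1) := 'D_(ex k) g z in
  let gt := 'D_et g z in
  let gxx (j k : 'I_n.-1) := 'D_(ex k) ('D_(ex j) g) z in
  let gxt (k : 'I_n.-1) := 'D_et ('D_(ex k) g) z in
  let gtt := 'D_et ('D_et g) z in
  \sum_(k < n.-1)
     (g z ^+ 2 * (1 + \sum_(j < n.-1 | j != k) gx j ^+ 2) + gt ^+ 2
        + eps / (n%:R - 1)) * gxx k k
  + (1 + \sum_(k < n.-1) gx k ^+ 2) * gtt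
  - 2 * (\sum_(k < n.-1) gx k * gt * gxt k)
  - 2 * g z ^+ 2 *
      (\sum_(k < n.-1) \sum_(j < n.-1 | (j < k)%N) gx j * gx k * gxx j k)
  + (n%:R - 1) * g z * (1 + \sum_(k < n.-1) gx k ^+ 2)
  + (n%:R - 2) * (gt ^+ 2 / g z).

Definition bdry Om : set (pt R n) := closure Om `\` interior Om.

(* C^0 domain, in the sense of Gilbarg-Trudinger: near
   each boundary point some homeomorphism onto an open set straightens the
   boundary and sends the domain to one side. This includes the domains that
   are locally the epigraph of a continuous function. *)
Definition C0_boundary Om : Prop :=
  forall p, bdry Om p ->
  exists (B : set (pt R n)) (psi phi : pt R n -> pt R n),
    [/\ open B /\ B p,
        open (psi @` B),
        {within B, continuous psi} /\ {within psi @` B, continuous phi},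
        forall z, B z -> phi (psi z) = z &
        (forall z, B z -> Om z -> 0 < (psi z).2) /\
        (forall z, B z -> bdry Om z -> (psi z).2 = 0)].

Definition bounded_C0_domain Om : Prop :=
  [/\ open Om, connected Om, Om !=set0, bounded_set Om & C0_boundary Om].

End HorizontalMinimalEquation.

Section HeightBound.
Context {R : realType}.

Definition edist (m : nat) (x c : 'rV[R]_m) : R :=
  Num.sqrt (\sum_(k < m) (x 0 k - c 0 k) ^+ 2).

(* Infimum of the radii of the closed round disks centred in P containing P:
   the infimum need not be attained when P is open. *)
Definition disk_radius (m : nat) (P : set 'rV[R]_m) : R :=
  inf [set r | exists2 c, P c & forall x, P x -> edist x c <= r].

(* Oscillation of the coordinate x, for n = 2. *)
Definition xwidth (G : set (pt R 2)) : R :=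
  sup [set z.1 0 0 | z in G] - inf [set z.1 0 0 | z in G].

Definition hradius (n : nat) : set (pt R n) -> R :=
  match n with
  | 2 => fun Om => xwidth (bdry Om) / 2
  | _ => fun Om => disk_radius (fst @` Om)
  end.

Definition Rbound (n : nat) (Om : set (pt R n)) (f : pt R n -> R) : R :=
  Num.sqrt (sup [set f z ^+ 2 | z in bdry Om] + hradius Om ^+ 2).

End HeightBound.

(* Main.v *)
Require Import Defs.
From mathcomp Require Import all_boot all_order all_algebra.
From mathcomp Require Import all_classical all_reals all_analysis.
From mathcomp Require Import ring lra.
Import Order.TTheory GRing.Theory Num.Theory.
Import numFieldNormedType.Exports.
Local Open Scope classical_set_scope.
Local Open Scope ring_scope.

(** The function g^2 + |x - c|^2 is a subsolution, without first-order terms, of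
    the linear elliptic operator whose coefficients are those of the minimal
    equation frozen along g: at a solution the operator gives
    2 g_t^2 + eps/(n-1) (n - 1 + |g_x|^2) >= 0. By the strong maximum principle
    its maximum over the closure is attained on the boundary, and an interior
    maximum propagates along the vertical line through it up to the boundary.
    If g reached the bound at z, then x(z) would be the centre c of a smallest
    disk, and z a maximum point of g^2 + |x - c|^2; the boundary point above z
    then forces the radius to be 0, which an open set excludes. At an interior
    minimum of g all terms of the equation are nonnegative and (n-1) g is
    positive. *)

(** * Second-order expansions of functions of one real variable *)

Section Taylor2.
Context {R : realType}.
Implicit Types (u v du ddu : R -> R) (a b c e r s H : R).

(* [u s = a + b s + c s^2 + o(s^2)] as [s] tends to 0, the remainder being
   absorbed in the coefficient of [s^2]. *)
Definition taylor2 u a b c : Prop := exists k : R -> R,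
  [/\ {for 0, continuous k}, k 0 = c & forall s, u s = a + b * s + k s * s ^+ 2].

Lemma taylor2_poly a b c : taylor2 (fun s => a + b * s + c * s ^+ 2) a b c.
Proof. by exists (fun=> c); split => //; exact: cst_continuous. Qed.

Lemma taylor2D {u v a b c a' b' c'} : taylor2 u a b c -> taylor2 v a' b' c' ->
  taylor2 (fun s => u s + v s) (a + a') (b + b') (c + c').
Proof.
move=> [k [kc k0 ku]] [l [lc l0 lv]].
exists (fun s => k s + l s); split; [exact: cvgD | by rewrite k0 l0|].
by move=> s; rewrite ku lv; ring.
Qed.

Lemma taylor2M {u v a b c a' b' c'} : taylor2 u a b c -> taylor2 v a' b' c' ->
  taylor2 (fun s => u s * v s) (a * a') (a * b' + a' * b)
    (a * c' + b * b' + a' * c).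
Proof.
move=> [k [kc k0 ku]] [l [lc l0 lv]].
(* All terms of the product of degree at least 2, divided by [s ^+ 2]. *)
exists (fun s => a * l s + b * b' + a' * k s + s * (b * l s + b' * k s)
         + k s * l s * s ^+ 2); split.
- have idc : {for (0 : R), continuous (@idfun R)} by exact: cvg_id.
  have cc (x : R) : {for (0 : R), continuous (fun _ : R => x)}.
    exact: cst_continuous.
  apply: cvgD; first (apply: cvgD; first (apply: cvgD; first apply: cvgD)).
  + by apply: cvgM => //; exact: cc.
  + exact: cc.
  + by apply: cvgM => //; exact: cc.
  + apply: cvgM => //; apply: cvgD; apply: cvgM => //; exact: cc.
  + by apply: cvgM; [exact: cvgM | exact: (cvgM idc idc)].
- by rewrite k0 l0; ring.
- by move=> s; rewrite ku lv; ring.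
Qed.

Lemma eq_taylor2 {u v a b c} : u =1 v -> taylor2 u a b c -> taylor2 v a b c.
Proof. by move=> uv [k [kc k0 ku]]; exists k; split=> // s; rewrite -uv. Qed.

Lemma taylor2_sum (I : finType) (P : pred I) (u : I -> R -> R) (a b c : I -> R) :
  (forall i, P i -> taylor2 (u i) (a i) (b i) (c i)) ->
  taylor2 (fun s => \sum_(i | P i) u i s)
    (\sum_(i | P i) a i) (\sum_(i | P i) b i) (\sum_(i | P i) c i).
Proof.
move=> h; suff H (r : seq I) : taylor2 (fun s => \sum_(i <- r | P i) u i s)
    (\sum_(i <- r | P i) a i) (\sum_(i <- r | P i) b i) (\sum_(i <- r | P i) c i).
  exact: H.
elim: r => [|i r IH].
  apply: eq_taylor2 (taylor2_poly _ _ _) => s.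
  by rewrite !big_nil; ring.
rewrite !big_cons; case: ifPn => Pi.
  by apply: eq_taylor2 (taylor2D (h i Pi) IH) => s; rewrite big_cons Pi.
by apply: eq_taylor2 IH => s; rewrite big_cons (negbTE Pi).
Qed.

Lemma taylor2X {u a b c} (n : nat) : taylor2 u a b c ->
  taylor2 (fun s => u s ^+ n.+2) (a ^+ n.+2) (n.+2%:R * a ^+ n.+1 * b)
    (n.+2%:R * a ^+ n * (a * c + n.+1%:R / 2 * b ^+ 2)).
Proof.
move=> h; elim: n => [|n IH].
  apply: (eq_taylor2 (u := fun s => u s * u s)); first by move=> s; rewrite expr2.
  have := taylor2M h h.
  by congr taylor2; rewrite ?exprS ?expr0; field.
apply: (eq_taylor2 (u := fun s => u s * u s ^+ n.+2)).
  by move=> s; rewrite [in RHS]exprS.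
have := taylor2M h IH.
by congr taylor2; rewrite !exprS ?expr0 -?(addn3 n) -?(addn2 n) -?(addn1 n) ?natrD; field.
Qed.

(** The hypothesis reads [s * (b + k s * s) <= 0] near 0. If [b] were not 0, the bracket would keep
    its sign near 0, and a small [s] of that sign would violate this; once [b = 0], so would any
    small positive [s] if [k 0 = c] were positive. *)
Lemma taylor2_max {u a b c} : taylor2 u a b c ->
  (\forall s \near 0, u s <= a) -> b = 0 /\ c <= 0.
Proof.
move=> [k [kc k0 ku]] /nbhs_ballP [d /= d0 dle].
have le s : `|s| < d -> s * (b + k s * s) <= 0.
  move=> sd; have := dle s; rewrite /ball /= sub0r normrN => /(_ sd).
  rewrite ku => h; have -> : s * (b + k s * s) = b * s + k s * s ^+ 2 by ring.
  lra.
have b0 : b = 0.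
  have cb : (fun s => b + k s * s) s @[s --> 0] --> b + k 0 * 0.
    by apply: cvgD; [exact: cvg_cst | apply: cvgM => //; exact: cvg_id].
  rewrite mulr0 addr0 in cb.
  have [bn|bp|//] := ltgtP b 0.
    have /nbhs_ballP[e /= e0 ele] : \forall s \near 0, b + k s * s < 0.
      exact: (cvgr_lt _ cb).
    pose s := - (Num.min d e / 2).
    have m0 : 0 < Num.min d e by rewrite lt_min d0.
    have s0 : s < 0 by rewrite /s; lra.
    have sm : `|s| < Num.min d e by rewrite ltr0_norm // /s; lra.
    move: sm; rewrite lt_min => /andP[/le h1 h2].
    by have := ele s; rewrite /ball /= sub0r normrN => /(_ h2) ?; nra.
  have /nbhs_ballP[e /= e0 ele] : \forall s \near 0, 0 < b + k s * s.
    exact: (cvgr_gt _ cb).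
  pose s := (Num.min d e / 2).
  have m0 : 0 < Num.min d e by rewrite lt_min d0.
  have s0 : 0 < s by rewrite /s; lra.
  have sm : `|s| < Num.min d e by rewrite gtr0_norm // /s; lra.
  move: sm; rewrite lt_min => /andP[/le h1 h2].
  by have := ele s; rewrite /ball /= sub0r normrN => /(_ h2) ?; nra.
split=> //; rewrite leNgt; apply/negP => c0.
rewrite -k0 in c0; have /nbhs_ballP[e /= e0 ele] : \forall s \near 0, 0 < k s.
  exact: (cvgr_gt _ kc).
pose s := (Num.min d e / 2).
have m0 : 0 < Num.min d e by rewrite lt_min d0.
have s0 : 0 < s by rewrite /s; lra.
have sm : `|s| < Num.min d e by rewrite gtr0_norm // /s; lra.
move: sm; rewrite lt_min => /andP[/le h1 h2].
have := ele s; rewrite /ball /= sub0r normrN => /(_ h2) ks.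
move: h1; rewrite b0 add0r => h1.
by have := mulr_gt0 s0 (mulr_gt0 ks s0); lra.
Qed.

(** The quotient [(u s - a - b * s) / s ^+ 2], given the value [c] at 0, serves as remainder
    coefficient; the assumed estimate is its continuity there. *)
Lemma taylor2_intro u a b c : u 0 = a ->
  (forall e, 0 < e -> \forall s \near 0,
     `|u s - (a + b * s + c * s ^+ 2)| <= e * s ^+ 2) ->
  taylor2 u a b c.
Proof.
move=> u0 h.
exists (fun s => if s == 0 then c else (u s - a - b * s) / s ^+ 2); split.
- rewrite /prop_for /continuous_at /= eqxx; apply/cvgrPdist_le => e /= e0.
  have := h _ e0; apply: filterS => s; case: eqVneq => [->|s0 hs].
    by move=> _; rewrite subrr normr0 ltW.
  have s2 : 0 < s ^+ 2 by rewrite exprn_even_gt0.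
  rewrite -(ler_pM2r s2) distrC -[X in _ * X <= _](gtr0_norm s2) -normrM.
  suff -> : ((u s - a - b * s) / s ^+ 2 - c) * s ^+ 2 =
    u s - (a + b * s + c * s ^+ 2) by [].
  by field.
- by rewrite eqxx.
- move=> s; case: eqVneq => [->|s0]; first by rewrite u0; ring.
  by field.
Qed.

Lemma mean_value0 u du s :
  (forall r, `|r| <= `|s| -> is_derive r 1 u (du r)) ->
  exists2 r, `|r| <= `|s| & u s - u 0 = du r * s.
Proof.
move=> h.
have cu (a b : R) : (forall x, x \in `[a, b] -> `|x| <= `|s|) ->
    {within `[a, b], continuous u}.
  move=> hab; apply: derivable_within_continuous => x xab.
  by have [] := h _ (hab _ xab).
have [s0|s0|s0] := ltgtP s 0.
- have H x : x \in `[s, 0] -> `|x| <= `|s|.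
    by rewrite in_itv /= => /andP[h1 h2]; rewrite !ler0_norm ?lerN2 // ltW.
  have [|r rI e] := @MVT _ u du s 0 s0 _ (cu _ _ H).
    by move=> x /subset_itv_oo_cc xI; apply: h; exact: H.
  exists r; first by apply: H; exact: subset_itv_oo_cc.
  by rewrite -opprB e; ring.
- have H x : x \in `[0, s] -> `|x| <= `|s|.
    by rewrite in_itv /= => /andP[h1 h2]; rewrite !ger0_norm // ltW.
  have [|r rI e] := @MVT _ u du 0 s s0 _ (cu _ _ H).
    by move=> x /subset_itv_oo_cc xI; apply: h; exact: H.
  exists r; first by apply: H; exact: subset_itv_oo_cc.
  by rewrite e subr0.
- by exists 0; rewrite ?normr0 ?normr_ge0 // s0; ring.
Qed.

(** Two mean values, one for [u] minus its quadratic model and one for [du], turn the error into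
    [(ddu t - H) * r * s] with [|t| <= |r| <= |s|]. [H] need not be [ddu 0], so a segment starting
    near a point can be compared with the Hessian at that point. *)
Lemma mean_value2 u du ddu H e s :
  (forall r, `|r| <= `|s| -> is_derive r 1 u (du r)) ->
  (forall r, `|r| <= `|s| -> is_derive r 1 du (ddu r)) ->
  (forall r, `|r| <= `|s| -> `|ddu r - H| <= e) ->
  `|u s - (u 0 + du 0 * s + H / 2 * s ^+ 2)| <= e * s ^+ 2.
Proof.
move=> hu hdu hddu.
have e0 : 0 <= e by apply: le_trans (hddu 0 _); rewrite ?normr0.
pose w := fun r => u r - du 0 * r - H / 2 * r ^+ 2.
pose dw := fun r => du r - du 0 - H * r.
have [|r rs ws] := @mean_value0 w dw s.
  move=> r rs; have ? := hu r rs.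
  apply: is_derive_eq; rewrite /dw /GRing.scale /=; by field.
have [|t ts ds] := @mean_value0 du ddu r.
  by move=> t ts; apply: hdu; exact: le_trans rs.
have -> : u s - (u 0 + du 0 * s + H / 2 * s ^+ 2) = (ddu t - H) * r * s.
  transitivity (w s - w 0); first by rewrite /w; ring.
  rewrite ws /dw; congr (_ * _); rewrite mulrBl -ds; ring.
rewrite !normrM -(ger0_norm (sqr_ge0 s)) normrX expr2 mulrA.
apply: ler_pM; rewrite ?mulr_ge0 //.
by apply: ler_pM => //; apply: hddu; exact: le_trans rs.
Qed.

End Taylor2.

(** * Norm balls, and derivatives along lines *)

Section BallForall.
Context {R : realType} {V : normedModType R}.
Implicit Types (z : V) (P Q : V -> Prop) (D : set V) (u : V -> R).

Definition ball_forall z P : Prop :=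
  exists2 d : R, 0 < d & forall w, `|w - z| < d -> P w.

Lemma ball_forallI {z P Q} : ball_forall z P -> ball_forall z Q ->
  ball_forall z (fun w => P w /\ Q w).
Proof.
move=> [d d0 dP] [e e0 eQ]; exists (Num.min d e); first by rewrite lt_min d0.
by move=> w; rewrite lt_min => /andP[/dP ? /eQ ?].
Qed.

Lemma ball_forallS {z P Q} : (forall w, P w -> Q w) ->
  ball_forall z P -> ball_forall z Q.
Proof. by move=> PQ [d d0 dP]; exists d => // w /dP /PQ. Qed.

Lemma nbhs_ball {z P} : nbhs z P <-> ball_forall z P.
Proof.
split=> [/nbhs_ballP[d /= d0 dP]|[d d0 dP]].
  exists d => // w wd; apply: dP.
  by rewrite -ball_normE /ball_ /= distrC.
apply/nbhs_ballP; exists d => // w.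
by rewrite -ball_normE /ball_ /= distrC; exact: dP.
Qed.

Lemma open_ball {D z} : open D -> D z -> ball_forall z D.
Proof. by rewrite openE => oD Dz; apply/nbhs_ball; exact: oD. Qed.

Lemma continuous_ball {u z} {e : R} : {for z, continuous u} -> 0 < e ->
  ball_forall z (fun w => `|u w - u z| <= e).
Proof.
move=> /cvgrPdist_le cu e0; apply/nbhs_ball; have := cu _ e0.
by apply: filterS => w; rewrite distrC.
Qed.

End BallForall.

Lemma is_derive_line {R : realType} {V : normedModType R} (g : V -> R)
    (z v : V) (r : R) : derivable g (z + r *: v) v ->
  is_derive r 1 (fun s => g (z + s *: v)) ('D_v g (z + r *: v)).
Proof.
have E : (fun h => h^-1 *: (((fun s => g (z + s *: v)) \o shift r) (h *: 1)
             - g (z + r *: v)))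
    = (fun h => h^-1 *: ((g \o shift (z + r *: v)) (h *: v) - g (z + r *: v))).
  apply/funext => h /=; congr (_ *: (g _ - _)).
  by rewrite [h *: 1]mulr1 scalerDl addrCA.
by move=> dg; split; rewrite /derivable /derive E.
Qed.

(** * Second-order expansion of a C^2 function along a line *)

Section Hessian.
Context {R : realType} {n : nat}.
Implicit Types (g : pt R n -> R) (D : set (pt R n)) (z : pt R n).

(** The index [i] is differentiated first, the order of [gxx] and [gxt] in [hminop]. *)
Definition hess g z (i j : option 'I_n.-1) : R :=
  'D_(axis j) ('D_(axis i) g) z.

Lemma Ck2_derivable {D g z} i : Ck 2 D g -> D z -> derivable g z (axis i).
Proof. by move=> [_ /(_ i)[h _]] Dz; exact: h. Qed.

Lemma Ck2_derivable2 {D g z} i j : Ck 2 D g -> D z ->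
  derivable ('D_(axis i) g) z (axis j).
Proof. by move=> [_ /(_ i)[_ [_ /(_ j)[h _]]]] Dz; exact: h. Qed.

Lemma Ck2_continuous {D g z} : Ck 2 D g -> D z -> {for z, continuous g}.
Proof. by move=> [h _] Dz; exact: h. Qed.

Lemma Ck2_continuous_grad {D g z} i : Ck 2 D g -> D z ->
  {for z, continuous ('D_(axis i) g)}.
Proof. by move=> [_ /(_ i)[_ [h _]]] Dz; exact: h. Qed.

Lemma Ck2_continuous_hess {D g z} i j : Ck 2 D g -> D z ->
  {for z, continuous (fun w => hess g w i j)}.
Proof. by move=> [_ /(_ i)[_ [_ /(_ j)[_ [h _]]]]] Dz; exact: h. Qed.

(* The step along [axis i] precedes the one along [axis j], so that a single
   mixed derivative occurs and no symmetry of the Hessian is needed. *)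
Lemma Ck2_taylor2 {D g z} (al be : R) i j : open D -> Ck 2 D g -> D z ->
  taylor2 (fun s => g (z + s *: (al *: axis i + be *: axis j)))
    (g z) (al * 'D_(axis i) g z + be * 'D_(axis j) g z)
    ((al ^+ 2 * hess g z i i + 2 * al * be * hess g z j i
      + be ^+ 2 * hess g z j j) / 2).
Proof.
move=> oD gC Dz; apply: taylor2_intro; first by rewrite scale0r addr0.
move=> e e0.
(* [M] is the total weight of the three Hessian errors below, so that [e' * M <= e]; the [+ 1] keeps
   the divisor positive. *)
pose M := al ^+ 2 + `|al * be| + be ^+ 2.
have M0 : 0 <= M by rewrite !addr_ge0 // sqr_ge0.
pose e' := e / (M + 1).
have e'0 : 0 < e' by rewrite divr_gt0 // ltr_wpDl.
have ballH i' j' : ball_forall z (fun w => `|hess g w i' j' - hess g z i' j'| <= e').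
  exact: continuous_ball (Ck2_continuous_hess i' j' gC Dz) e'0.
have [d d0 dP] := ball_forallI (open_ball oD Dz)
  (ball_forallI (ballH i i) (ball_forallI (ballH j i) (ballH j j))).
(* For [|s| < d / K] both legs of the path stay within distance [d] of [z]. *)
pose K := `|al| * `|axis i : pt R n| + `|be| * `|axis j : pt R n| + 1.
have K0 : 0 < K by rewrite ltr_wpDl // addr_ge0 // mulr_ge0.
have dK0 : 0 < d / K by rewrite divr_gt0.
apply/nbhs_ballP; exists (d / K) => //= s; rewrite /ball /= sub0r normrN => sd.
have inb p q : `|p| <= `|s * al| -> `|q| <= `|s * be| ->
    `|z + p *: axis i + q *: axis j - z| < d.
  move=> ps qs; rewrite -(addrA z) (addrC z) addrK.
  apply: (@le_lt_trans _ _ (`|s| * K)); last by rewrite -ltr_pdivlMr.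
  apply: le_trans (ler_normD _ _) _; rewrite !normrZ.
  rewrite /K !mulrDr mulr1 ler_wpDr // !mulrA -!normrM.
  by apply: lerD; exact: ler_wpM2r.
have A1 := @mean_value2 R (fun r => g (z + r *: axis i))
  (fun r => 'D_(axis i) g (z + r *: axis i))
  (fun r => hess g (z + r *: axis i) i i) (hess g z i i) e' (s * al).
have inb0 p : `|p| <= `|s * al| -> `|z + p *: axis i - z| < d.
  move=> ps; have := inb p 0 ps; rewrite normr0 scale0r addr0; exact.
pose z' := z + (s * al) *: axis i.
have A2 := @mean_value2 R (fun r => g (z' + r *: axis j))
  (fun r => 'D_(axis j) g (z' + r *: axis j))
  (fun r => hess g (z' + r *: axis j) j j) (hess g z j j) e' (s * be).
have [|r rs A3] := @mean_value0 R (fun r => 'D_(axis j) g (z + r *: axis i))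
  (fun r => hess g (z + r *: axis i) j i) (s * al).
  move=> r rs; apply: is_derive_line; apply: Ck2_derivable2 gC _.
  by have [? _] := dP _ (inb0 r rs).
have {}A1 : `|g z' - (g z + 'D_(axis i) g z * (s * al)
    + hess g z i i / 2 * (s * al) ^+ 2)| <= e' * (s * al) ^+ 2.
  rewrite scale0r addr0 in A1; apply: A1 => p ps.
  - by apply: is_derive_line; apply: Ck2_derivable gC _; have [? _] := dP _ (inb0 p ps).
  - by apply: is_derive_line; apply: Ck2_derivable2 gC _; have [? _] := dP _ (inb0 p ps).
  - by have [_ [h _]] := dP _ (inb0 p ps); exact: h.
have {}A2 : `|g (z' + (s * be) *: axis j) - (g z' + 'D_(axis j) g z' * (s * be)
    + hess g z j j / 2 * (s * be) ^+ 2)| <= e' * (s * be) ^+ 2.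
  rewrite scale0r addr0 in A2; apply: A2 => p ps.
  - by apply: is_derive_line; apply: Ck2_derivable gC _; have [? _] := dP _ (inb _ p (lexx _) ps).
  - by apply: is_derive_line; apply: Ck2_derivable2 gC _; have [? _] := dP _ (inb _ p (lexx _) ps).
  - by have [_ [_ [_ h]]] := dP _ (inb _ p (lexx _) ps); exact: h.
rewrite scale0r addr0 in A3.
have [_ [_ [B3 _]]] := dP _ (inb0 r rs).
have -> : z + s *: (al *: axis i + be *: axis j) = z' + (s * be) *: axis j.
  by rewrite /z' scalerDr !scalerA addrA.
set G := g (z' + _) in A2 *.
have C3 : `|(hess g (z + r *: axis i) j i - hess g z j i) * (s * al * (s * be))|
    <= e' * (`|al * be| * s ^+ 2).
  rewrite normrM; apply: ler_pM => //.
  have -> : s * al * (s * be) = al * be * s ^+ 2 by ring.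
  by rewrite normrM (ger0_norm (sqr_ge0 s)).
set h3 := hess g (z + _) j i in B3 A3 C3.
have eM : e' * M * s ^+ 2 <= e * s ^+ 2.
  apply: ler_wpM2r; first exact: sqr_ge0.
  by rewrite /e' mulrAC ler_pdivrMr ?ltr_wpDl // (ler_pM2l e0); lra.
apply: le_trans eM.
have -> : e' * M * s ^+ 2 = e' * (s * al) ^+ 2 + e' * (s * be) ^+ 2
   + e' * (`|al * be| * s ^+ 2) by rewrite /M; ring.
set L := (X in `|X|).
(* The error of the first leg, that of the second leg, and the error in the change of the [axis j]
   derivative along the first leg. *)
have -> : L = (g z' - (g z + 'D_(axis i) g z * (s * al)
    + hess g z i i / 2 * (s * al) ^+ 2))
  + (G - (g z' + 'D_(axis j) g z' * (s * be)
    + hess g z j j / 2 * (s * be) ^+ 2))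
  + (h3 - hess g z j i) * (s * al * (s * be)).
  have -> : 'D_(axis j) g z' = 'D_(axis j) g z + h3 * (s * al).
    by rewrite -A3; ring.
  rewrite /L; clearbody G h3; move: (hess g z i i) => h1.
  move: (hess g z j j) (hess g z j i) => h2 h4.
  move: ('D_(axis i) g z) ('D_(axis j) g z) (g z) (g z') => d1 d2 g1 g2.
  by field.
apply: le_trans (ler_normD _ _) _; apply: lerD C3.
exact: le_trans (ler_normD _ _) (lerD A1 A2).
Qed.
End Hessian.

(** * An elliptic operator as a weighted sum of second directional derivatives *)

Section EllipticOperator.
Context {R : realFieldType} {m : nat}.
Implicit Types (A e tau : R) (p : 'I_m -> R) (x : option 'I_m -> R).
Implicit Types (c : R -> option 'I_m -> R -> option 'I_m -> R).

Lemma sum_option (F : option 'I_m -> R) :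
  \sum_l F l = \sum_k F (Some k) + F None.
Proof.
rewrite (bigD1 None) //= addrC; congr (_ + _).
by rewrite (reindex_omap Some id) //=; [apply: eq_bigl => k; rewrite eqxx | case].
Qed.

Lemma sum_isSome (F : option 'I_m -> R) :
  \sum_(l | isSome l) F l = \sum_k F (Some k).
Proof.
by rewrite (reindex_omap Some id) //=; [apply: eq_bigl => k; rewrite eqxx | case].
Qed.

Lemma sum_ltn_sym (F : 'I_m -> 'I_m -> R) :
  \sum_(k < m) \sum_(j < m | (j < k)%N) (F j k + F k j)
    = \sum_(k < m) \sum_(j < m | j != k) F j k.
Proof.
under eq_bigr do rewrite big_split /=.
rewrite big_split /= [X in _ + X](exchange_big_dep xpredT) //= -big_split /=.
apply: eq_bigr => k _.
rewrite [RHS](bigID (fun j : 'I_m => (j < k)%N)) /=; congr (_ + _);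
  apply: eq_bigl => j; rewrite -(inj_eq val_inj) /= neq_ltn; case: ltngtP => //.
Qed.

(** Pythagoras for [al e_i + be e_j]; the alternative [be == 0] admits [i = j], which is how pure
    derivatives are passed to the forms. *)
Lemma sum_delta (T : finType) (P : pred T) (al be : R) (i j : T) :
  (i != j) || (be == 0) ->
  \sum_(l | P l) (al * (l == i)%:R + be * (l == j)%:R) ^+ 2
    = al ^+ 2 * (P i)%:R + be ^+ 2 * (P j)%:R.
Proof.
move=> ij; have E (x : R) (k : T) :
    \sum_(l | P l) (x ^+ 2 * (l == k)%:R) = x ^+ 2 * (P k)%:R.
  rewrite big_mkcond (bigD1 k) //= eqxx big1 ?addr0 ?mulr1.
    by case: (P k); rewrite ?mulr1 ?mulr0.
  by move=> l /negbTE ->; rewrite mulr0 if_same.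
rewrite -!E -big_split /=; apply: eq_bigr => l _.
case/orP: ij => [ij|/eqP ->]; last by case: eqP => _ /=; ring.
case: eqP => [->|_]; last by case: eqP => _ /=; ring.
by rewrite (negbTE ij) /=; ring.
Qed.

(* [c al i be j] stands for the value of a quadratic form on the vector
   [al e_i + be e_j]. The principal part of the minimal operator is the sum of
   the second derivatives along e_k, p_j e_k - p_k e_j, e_t and
   tau e_k - p_k e_t, with the weights A + e, A, 1 and 1. *)
Definition ellop A e p tau c : R :=
  \sum_k (A + e) * c 1 (Some k) 0 (Some k)
  + A * (\sum_(k < m) \sum_(j < m | (j < k)%N) c (p j) (Some k) (- p k) (Some j))
  + c 1 None 0 None + \sum_k c (- p k) None tau (Some k).

Definition sqlin x al i be j : R := (al * x i + be * x j) ^+ 2.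

(** The coefficient of [s ^+ 2] in [sqdist P] along a line. *)
Definition sqnorm (P : pred (option 'I_m)) al i be j : R :=
  \sum_(l | P l) (al * (l == i)%:R + be * (l == j)%:R) ^+ 2.

Lemma ellopD A e p tau c c' :
  ellop A e p tau (fun al i be j => c al i be j + c' al i be j)
    = ellop A e p tau c + ellop A e p tau c'.
Proof.
rewrite /ellop; under eq_bigr do rewrite mulrDr.
under [X in A * X]eq_bigr do rewrite big_split /=.
rewrite !big_split /=; ring.
Qed.

Lemma ellopZ A e p tau (a : R) c :
  ellop A e p tau (fun al i be j => a * c al i be j) = a * ellop A e p tau c.
Proof.
rewrite /ellop; under eq_bigr do rewrite mulrCA.
under [X in A * X]eq_bigr do rewrite -mulr_sumr.
rewrite -!mulr_sumr; ring.
Qed.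

Lemma ellop_le0 A e p tau c : 0 <= A -> 0 <= e ->
  (forall al i be j, c al i be j <= 0) -> ellop A e p tau c <= 0.
Proof.
move=> A0 e0 c0; rewrite /ellop.
have h1 : \sum_k (A + e) * c 1 (Some k) 0 (Some k) <= 0.
  by apply: sumr_le0 => k _; rewrite mulr_ge0_le0 // addr_ge0.
have h2 : A * (\sum_(k < m) \sum_(j < m | (j < k)%N)
    c (p j) (Some k) (- p k) (Some j)) <= 0.
  by rewrite mulr_ge0_le0 //; apply: sumr_le0 => k _; exact: sumr_le0.
have h3 : \sum_k c (- p k) None tau (Some k) <= 0 by exact: sumr_le0.
have := c0 1 None 0 None; lra.
Qed.

(** Ellipticity: the directions e_k and e_t already have weights at least [Num.min A 1], and the
    mixed directions only add squares. *)
Lemma ellop_sqlin_ge A e p tau x : 0 <= A -> 0 <= e ->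
  Num.min A 1 * (\sum_l x l ^+ 2) <= ellop A e p tau (sqlin x).
Proof.
move=> A0 e0; rewrite sum_option mulrDr /ellop /sqlin.
have h1 : Num.min A 1 * (\sum_k x (Some k) ^+ 2)
    <= \sum_k (A + e) * (1 * x (Some k) + 0 * x (Some k)) ^+ 2.
  rewrite mulr_sumr; apply: ler_sum => k _.
  rewrite mul0r addr0 mul1r ler_wpM2r ?sqr_ge0 //.
  by rewrite ge_min lerDl e0.
have h2 : Num.min A 1 * x None ^+ 2 <= (1 * x None + 0 * x None) ^+ 2.
  rewrite mul0r addr0 mul1r -[leRHS]mul1r ler_wpM2r ?sqr_ge0 //.
  by rewrite ge_min lexx orbT.
have h3 : 0 <= A * (\sum_(k < m) \sum_(j < m | (j < k)%N)
    (p j * x (Some k) + - p k * x (Some j)) ^+ 2).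
  by rewrite mulr_ge0 // !sumr_ge0 // => k _; rewrite sumr_ge0 // => j _; exact: sqr_ge0.
have h4 : 0 <= \sum_k (- p k * x None + tau * x (Some k)) ^+ 2.
  by rewrite sumr_ge0 // => k _; exact: sqr_ge0.
lra.
Qed.

(** The mixed directions are orthogonal to the gradient [(p, tau)], so only the coordinate
    directions contribute. *)
Lemma ellop_sqlin_grad A e p tau :
  ellop A e p tau (sqlin (oapp p tau)) = (A + e) * (\sum_k p k ^+ 2) + tau ^+ 2.
Proof.
rewrite /ellop /sqlin /= [X in A * X]big1 => [|k _]; last first.
  by rewrite big1 // => j _; ring.
rewrite [X in _ + X]big1 => [|k _]; last by ring.
under eq_bigr do rewrite mul0r addr0 mul1r.
rewrite -mulr_sumr; ring.
Qed.

Lemma sum_pairs p :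
  \sum_(k < m) \sum_(j < m | (j < k)%N) (p j ^+ 2 + p k ^+ 2)
    = (m%:R - 1) * \sum_k p k ^+ 2.
Proof.
rewrite (sum_ltn_sym (fun j k => p j ^+ 2)).
have E k : \sum_(j < m | j != k) p j ^+ 2 = \sum_j p j ^+ 2 - p k ^+ 2.
  by rewrite [in RHS](bigD1 k) //=; ring.
rewrite (eq_bigr _ (fun k _ => E k)) sumrB sumr_const card_ord -mulr_natl; ring.
Qed.

(** The weighted squared lengths of the directions are added up; [b] tells whether the coordinate t
    is counted. *)
Lemma ellop_sqnorm A e p tau (P : pred (option 'I_m)) (b : bool) :
  (forall k, P (Some k)) -> P None = b ->
  ellop A e p tau (sqnorm P) = m%:R * (A + e) + A * (m%:R - 1) * (\sum_k p k ^+ 2)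
    + m%:R * tau ^+ 2 + b%:R * (1 + \sum_k p k ^+ 2).
Proof.
move=> PS PN; rewrite /ellop /sqnorm.
under eq_bigr do rewrite sum_delta ?eqxx ?orbT // PS.
have E : \sum_(k < m) \sum_(j < m | (j < k)%N)
   \sum_(l | P l) (p j * (l == Some k)%:R + - p k * (l == Some j)%:R) ^+ 2
   = (m%:R - 1) * \sum_k p k ^+ 2.
  rewrite -sum_pairs; apply: eq_bigr => k _; apply: eq_bigr => j jk.
  rewrite sum_delta ?PS; first by rewrite !mulr1 sqrrN.
  by rewrite (inj_eq Some_inj) -(inj_eq val_inj) /= neq_ltn jk orbT.
rewrite {}E sum_delta ?eqxx ?orbT // PN.
under [X in _ + X = _]eq_bigr do rewrite sum_delta // PS PN.
rewrite sumr_const card_ord big_split /= sumr_const card_ord -mulr_suml.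
have -> : \sum_k (- p k) ^+ 2 = \sum_k p k ^+ 2.
  by apply: eq_bigr => k _; rewrite sqrrN.
ring.
Qed.

End EllipticOperator.

(** * The minimal operator and the squared height *)

Section MinimalOperator.
Context {R : realType} {n : nat}.
Implicit Types (g : pt R n -> R) (D : set (pt R n)) (y z c : pt R n).
Implicit Types (P : pred (option 'I_n.-1)).

(** The coefficient of [s ^+ 2] in [Ck2_taylor2], hence half a second derivative; the factor 2 in
    [ellop_qform] comes from here. *)
Definition qform (H : option 'I_n.-1 -> option 'I_n.-1 -> R) al i be j : R :=
  (al ^+ 2 * H i i + 2 * al * be * H j i + be ^+ 2 * H j j) / 2.

(** In each mixed direction the two vectors are listed in the order for which [qform] picks the
    mixed derivative that occurs in [hminop]; the diagonal parts regroup by [sum_ltn_sym]. *)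
Lemma ellop_qform (A e : R) (p : 'I_n.-1 -> R) tau H :
  2 * ellop A e p tau (qform H)
  = \sum_k (A * (1 + \sum_(j | j != k) p j ^+ 2) + tau ^+ 2 + e)
      * H (Some k) (Some k)
    + (1 + \sum_k p k ^+ 2) * H None None
    - 2 * (\sum_k p k * tau * H (Some k) None)
    - 2 * A * (\sum_(k < n.-1) \sum_(j < n.-1 | (j < k)%N)
        p j * p k * H (Some j) (Some k)).
Proof.
pose h k := H (Some k) (Some k).
have E1 : \sum_(k < n.-1) \sum_(j < n.-1 | (j < k)%N)
    qform H (p j) (Some k) (- p k) (Some j)
  = (\sum_k (\sum_(j | j != k) p j ^+ 2) * h k) / 2
    - \sum_(k < n.-1) \sum_(j < n.-1 | (j < k)%N)
        p j * p k * H (Some j) (Some k).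
  have -> : \sum_k (\sum_(j | j != k) p j ^+ 2) * h k
      = \sum_(k < n.-1) \sum_(j < n.-1 | j != k) p j ^+ 2 * h k.
    by apply: eq_bigr => k _; rewrite mulr_suml.
  rewrite -(sum_ltn_sym (fun j k => p j ^+ 2 * h k)) mulr_suml -sumrB.
  apply: eq_bigr => k _; rewrite mulr_suml -sumrB; apply: eq_bigr => j _.
  by rewrite /qform /h; field.
have E2 : \sum_k qform H (- p k) None tau (Some k)
  = (\sum_k p k ^+ 2) * H None None / 2 - \sum_k p k * tau * H (Some k) None
    + tau ^+ 2 * (\sum_k h k) / 2.
  rewrite 2!mulr_suml mulr_sumr mulr_suml -sumrB -big_split /=.
  by apply: eq_bigr => k _; rewrite /qform /h; field.
have E3 : \sum_k (A + e) * qform H 1 (Some k) 0 (Some k)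
    = (A + e) * (\sum_k h k) / 2.
  rewrite mulr_sumr mulr_suml; apply: eq_bigr => k _.
  by rewrite /qform /h; field.
have E4 : \sum_k (A * (1 + \sum_(j | j != k) p j ^+ 2) + tau ^+ 2 + e) * h k
    = (A + tau ^+ 2 + e) * (\sum_k h k)
      + A * (\sum_k (\sum_(j | j != k) p j ^+ 2) * h k).
  by rewrite 2!mulr_sumr -big_split /=; apply: eq_bigr => k _; ring.
by rewrite /ellop E1 E2 E3 E4 /qform; field.
Qed.

Definition xgrad g z (k : 'I_n.-1) : R := 'D_(ex k) g z.
Definition tgrad g z : R := 'D_et g z.
Definition minop eps g z := ellop (g z ^+ 2) (eps / (n%:R - 1)) (xgrad g z) (tgrad g z).

Lemma hminopE eps g z : hminop eps g z = 2 * minop eps g z (qform (hess g z))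
  + (n%:R - 1) * g z * (1 + \sum_(k < n.-1) xgrad g z k ^+ 2)
  + (n%:R - 2) * (tgrad g z ^+ 2 / g z).
Proof. by rewrite /minop ellop_qform. Qed.

(** The argument is the [s ^+ 2] coefficient of g^2 + |x - c|^2. The equation multiplied by [g z]
    replaces the Hessian term by terms of lower order; the other two forms cancel everything that
    carries [g z ^+ 2] and leave a nonnegative remainder. *)
Lemma minop_sqheight eps g z : (1 <= n)%N -> 0 < g z -> hminop eps g z = 0 ->
  minop eps g z (fun al i be j => 2 * g z * qform (hess g z) al i be j
     + sqlin (oapp (xgrad g z) (tgrad g z)) al i be j + sqnorm isSome al i be j)
  = 2 * tgrad g z ^+ 2
    + eps / (n%:R - 1) * (n.-1%:R + \sum_k xgrad g z k ^+ 2).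
Proof.
move=> n1 g0; rewrite hminopE /minop ellopD ellopD ellopZ ellop_sqlin_grad.
rewrite (@ellop_sqnorm _ _ _ _ _ _ _ false) //.
have -> : n.-1%:R = n%:R - 1 :> R by rewrite -[in RHS](prednK n1) -natr1 addrK.
set X := ellop _ _ _ _ _ => h.
have {}h : 2 * g z * X = - ((n%:R - 1) * g z ^+ 2 *
    (1 + \sum_k xgrad g z k ^+ 2) + (n%:R - 2) * tgrad g z ^+ 2).
  have E : (n%:R - 2) * tgrad g z ^+ 2
      = g z * ((n%:R - 2) * (tgrad g z ^+ 2 / g z)).
    by field; exact: lt0r_neq0.
  rewrite E; have := congr1 ( *%R (g z)) h; rewrite mulr0 => {}h.
  by rewrite -[LHS]subr0 -[X in _ - X = _]h; ring.
rewrite h /=; ring.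
Qed.

Definition co z (i : option 'I_n.-1) : R := if i is Some k then z.1 0 k else z.2.

Lemma co_line z (s al be : R) i j l :
  co (z + s *: (al *: axis i + be *: axis j)) l
    = co z l + (al * (l == i)%:R + be * (l == j)%:R) * s.
Proof.
have E k : co (axis k) l = (l == k)%:R.
  by case: k l => [k|] [l|] //=; rewrite !mxE ?eqxx.
rewrite -!E mulrC; case: l {E} => [l|] /=.
  by rewrite !mxE; case: i j => [i|] [j|].
by case: i j => [i|] [j|].
Qed.

(** [P = isSome] gives the squared distance of the x-parts, [P = xpredT] the full Euclidean one used
    for the barrier. *)
Definition sqdist P c z : R := \sum_(l | P l) (co z l - co c l) ^+ 2.

Lemma sqdist_taylor2 P c z (al be : R) i j :
  taylor2 (fun s => sqdist P c (z + s *: (al *: axis i + be *: axis j)))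
    (sqdist P c z)
    (\sum_(l | P l) 2 * (co z l - co c l) * (al * (l == i)%:R + be * (l == j)%:R))
    (sqnorm P al i be j).
Proof.
apply: taylor2_sum => l _.
apply: eq_taylor2 (taylor2_poly _ _ _) => s; rewrite co_line; ring.
Qed.

Lemma sqdistT_taylor2 c z (al be : R) i j :
  taylor2 (fun s => sqdist xpredT c (z + s *: (al *: axis i + be *: axis j)))
    (sqdist xpredT c z)
    (2 * (al * (co z i - co c i) + be * (co z j - co c j)))
    (sqnorm xpredT al i be j).
Proof.
have := sqdist_taylor2 xpredT c z al be i j; congr taylor2.
have E k : \sum_l (co z l - co c l) * (l == k)%:R = co z k - co c k.
  rewrite (bigD1 k) //= eqxx mulr1 big1 ?addr0 // => l /negbTE ->.
  by rewrite mulr0.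
rewrite -!E !mulr_sumr -big_split /= mulr_sumr.
by apply: eq_bigr => l _; ring.
Qed.

(** Geometrically, the squared Euclidean distance in the half-space from [(x, g z)] to the ideal
    point below [c]; in the half-space its level sets are totally geodesic hemispheres. *)
Definition sqheight g c z : R := g z ^+ 2 + sqdist isSome c z.

(* Hopf's barrier: the last inequality makes the operator frozen at [z]
   positive on [(C - sqdist y)^(N+2)]. *)
Lemma sqheight_barrier_nomax eps (D : set (pt R n)) g c y z (dl C : R) N :
  (2 <= n)%N -> 0 <= eps -> open D -> Ck 2 D g -> D z -> 0 < g z ->
  hminop eps g z = 0 -> 0 < dl -> 0 < C - sqdist xpredT y z ->
  (C - sqdist xpredT y z) * minop eps g z (sqnorm xpredT)
    < 2 * N.+1%:R * (Num.min (g z ^+ 2) 1 * sqdist xpredT y z) ->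
  ~ ball_forall z (fun w => sqheight g c w + dl * (C - sqdist xpredT y w) ^+ N.+2
      <= sqheight g c z + dl * (C - sqdist xpredT y z) ^+ N.+2).
Proof.
move=> n2 eps0 oD gC Dz gz0 Mz dl0 C0 hN [d d0 dmax].
set e := eps / (n%:R - 1); have e0 : 0 <= e.
  by rewrite divr_ge0 // subr_ge0 ler1n ltnW.
pose a := C - sqdist xpredT y z.
pose cu al i be j : R := 2 * g z * qform (hess g z) al i be j
     + sqlin (oapp (xgrad g z) (tgrad g z)) al i be j + sqnorm isSome al i be j.
(* The [s ^+ 2] coefficient of the barrier power is [N.+2%:R * a ^+ N] times this form. *)
pose cb al i be j : R := 2 * N.+1%:R * sqlin (fun l => co z l - co y l) al i be j
     + - a * sqnorm xpredT al i be j.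
have ccle al i be j : cu al i be j + dl * N.+2%:R * a ^+ N * cb al i be j <= 0.
  have T1 := Ck2_taylor2 al be i j oD gC Dz.
  have T2 := taylor2D (taylor2M T1 T1) (sqdist_taylor2 isSome c z al be i j).
  have T3 := taylor2D (taylor2_poly C 0 0)
    (taylor2M (taylor2_poly (- 1) 0 0) (sqdistT_taylor2 y z al be i j)).
  have T4 := taylor2D T2 (taylor2M (taylor2_poly dl 0 0) (taylor2X N T3)).
  have [|_] := taylor2_max T4.
    pose v : pt R n := al *: axis i + be *: axis j.
    have K0 : 0 < `|v| + 1 by rewrite ltr_wpDl.
    apply/nbhs_ballP; exists (d / (`|v| + 1)); first exact: divr_gt0.
    move=> s; rewrite /ball /= sub0r normrN ltr_pdivlMr // => sd.
    have := dmax (z + s *: v).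
    rewrite addrC addKr normrZ => /(_ (le_lt_trans _ sd)).
    rewrite ler_wpM2l ?lerDl // => /(_ isT).
    rewrite /sqheight !mul0r !addr0 !mulN1r -!expr2; apply.
  move=> h; apply: le_trans h; rewrite le_eqVlt; apply/orP; left; apply/eqP.
  have Ep k : oapp (xgrad g z) (tgrad g z) k = 'D_(axis k) g z by case: k.
  rewrite /cb /cu /a /sqlin !Ep /qform mulN1r.
  move: (sqnorm _ _ _ _ _) (sqnorm _ _ _ _ _) => s1 s2.
  move: (hess g z i i) => h1; move: (hess g z j j) (hess g z j i) => h2 h3.
  move: ('D_(axis i) g z) ('D_(axis j) g z) (g z) => d1 d2 g1.
  move: (co z i) (co z j) (co y i) (co y j) (sqdist xpredT y z) => *.
  by rewrite -(addn2 N) -(addn1 N) !natrD; field.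
(* An interior maximum makes this nonpositive, whereas [cu] contributes at least 0 by
   [minop_sqheight] and [cb] a positive amount by the assumed inequality on [N]. *)
have : minop eps g z
    (fun al i be j => cu al i be j + dl * N.+2%:R * a ^+ N * cb al i be j) <= 0.
  by apply: ellop_le0; rewrite ?sqr_ge0.
rewrite /minop ellopD ellopZ -/(minop eps g z cu) minop_sqheight //; last exact: ltnW.
rewrite ellopD !ellopZ -/(minop eps g z _) -/(minop eps g z _).
have := ellop_sqlin_ge (g z ^+ 2) e (xgrad g z) (tgrad g z) (fun l => co z l - co y l)
  (sqr_ge0 (g z)) e0.
rewrite -/(minop eps g z _) => h1.
have h2 : 0 <= 2 * tgrad g z ^+ 2
    + eps / (n%:R - 1) * (n.-1%:R + \sum_k xgrad g z k ^+ 2).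
  apply: addr_ge0; first by apply: mulr_ge0 => //; exact: sqr_ge0.
  apply: mulr_ge0 => //; apply: addr_ge0 => //.
  by apply: sumr_ge0 => k _; exact: sqr_ge0.
have a0 : 0 < dl * N.+2%:R * a ^+ N by rewrite !mulr_gt0 ?ltr0n ?exprn_gt0.
have h3 : 0 < 2 * N.+1%:R * minop eps g z (sqlin (fun l => co z l - co y l))
    + - a * minop eps g z (sqnorm xpredT).
  rewrite mulNr subr_gt0; apply: lt_le_trans hN _.
  by rewrite ler_wpM2l // mulr_ge0.
by have := mulr_gt0 a0 h3; lra.
Qed.

End MinimalOperator.

(** * Coordinates, continuity and compactness *)

Section PointTopology.
Context {R : realType} {n : nat}.
Implicit Types (u v : pt R n -> R) (y z c : pt R n) (S : set (pt R n)).
Implicit Types (P : pred (option 'I_n.-1)).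

Lemma pt_norm_le z (b : R) : 0 <= b ->
  (`|z| <= b) <-> (forall l, `|co z l| <= b).
Proof.
move=> b0; rewrite prod_normE ge_max -[`|z.1|]/(mx_norm z.1) mx_normrE; split.
  move=> /andP[/bigmax_leP[_ h1] h2] [k|] //=.
  exact: (h1 (0, k)).
move=> h; apply/andP; split; last exact: (h None).
by apply/bigmax_leP; split=> // -[i k] _ /=; rewrite ord1; exact: (h (Some k)).
Qed.

Lemma co_continuous l : continuous (fun z : pt R n => co z l).
Proof.
move=> z; case: l => [k|] /=.
  apply: (@continuous_comp _ _ _ fst (fun v : 'rV[R]_n.-1 => v 0 k)).
    exact: cvg_fst.
  exact: coord_continuous.
exact: cvg_snd.
Qed.

Lemma continuous_sum_at (I : finType) (P : pred I) (F : I -> pt R n -> R) z :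
  (forall i, P i -> {for z, continuous (F i)}) ->
  {for z, continuous (fun w => \sum_(i | P i) F i w)}.
Proof.
move=> h; apply: cvg_big => //; exact: add_continuous.
Qed.

Lemma continuous_sqr_at u z : {for z, continuous u} ->
  {for z, continuous (fun w => u w ^+ 2)}.
Proof. by move=> h; exact: (cvgM h h). Qed.

Lemma continuousX_at u z (N : nat) : {for z, continuous u} ->
  {for z, continuous (fun w => u w ^+ N)}.
Proof.
by move=> h; apply: (@continuous_comp _ _ _ u (fun x : R => x ^+ N) z h);
  exact: exprn_continuous.
Qed.

Lemma sqdist_continuous P c : continuous (sqdist P c).
Proof.
move=> z; apply: continuous_sum_at => l _; apply: continuous_sqr_at.
by apply: cvgB; [exact: co_continuous | exact: cvg_cst].
Qed.

Lemma sqheight_continuous g c z : {for z, continuous g} ->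
  {for z, continuous (sqheight g c)}.
Proof.
by move=> gc; apply: cvgD; [exact: continuous_sqr_at | exact: sqdist_continuous].
Qed.

Lemma pt_compact S (b : R) : closed S -> (forall z, S z -> `|z| <= b) ->
  compact S.
Proof.
move=> cS Sb; pose Q : set R := `[- b, b]%classic.
have cQ : compact Q by exact: segment_compact.
have cQn : compact [set v : 'rV[R]_n.-1 | forall k, Q (v 0 k)].
  exact: (@rV_compact _ _ (fun=> Q) (fun=> cQ)).
apply: (subclosed_compact cS (compact_setX cQn cQ)) => z Sz.
have b0 : 0 <= b by apply: le_trans (Sb z Sz).
have := Sb z Sz; rewrite pt_norm_le // => zb.
have zQ l : Q (co z l) by rewrite /Q /= in_itv /= -ler_norml.
by split; [move=> k; exact: (zQ (Some k)) | exact: (zQ None)].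
Qed.

Lemma sqdist_ge0 P c z : 0 <= sqdist P c z.
Proof. by apply: sumr_ge0 => l _; exact: sqr_ge0. Qed.

(** The sup norm is at most the Euclidean norm. *)
Lemma sqdistT_le_norm c z (r : R) : 0 <= r -> sqdist xpredT c z <= r ^+ 2 ->
  `|z - c| <= r.
Proof.
move=> r0 h; apply/pt_norm_le => // l.
have -> : co (z - c) l = co z l - co c l by case: l => [k|] //=; rewrite !mxE.
rewrite -(ler_pXn2r (n := 2)) ?nnegrE // real_normK ?num_real //.
apply: le_trans h; rewrite /sqdist (bigD1 l) //= lerDl.
by apply: sumr_ge0 => k _; exact: sqr_ge0.
Qed.

End PointTopology.

(** * The strong maximum principle along vertical lines *)

Section StrongMaximumPrinciple.
Context {R : realType} {n : nat}.
Implicit Types (D : set (pt R n)) (g : pt R n -> R) (y z c : pt R n).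

(** By [ellop_sqnorm] only [g] and its gradient enter; this bounds the operator near a maximum
    point. *)
Lemma minop_sqnormT_continuous eps D g z : Ck 2 D g -> D z ->
  {for z, continuous (fun w => minop eps g w (sqnorm xpredT))}.
Proof.
move=> gC Dz.
have E w : minop eps g w (sqnorm xpredT)
  = n.-1%:R * (g w ^+ 2 + eps / (n%:R - 1))
    + g w ^+ 2 * ((n.-1%:R - 1) * \sum_k xgrad g w k ^+ 2)
    + n.-1%:R * tgrad g w ^+ 2 + (1 + \sum_k xgrad g w k ^+ 2).
  by rewrite /minop (@ellop_sqnorm _ _ _ _ _ _ _ true) //=; ring.
have cc (x : R) : {for z, continuous (fun _ : pt R n => x)} by exact: cvg_cst.
have cg : {for z, continuous (fun w => g w ^+ 2)}.
  by apply: continuous_sqr_at; exact: Ck2_continuous gC Dz.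
have ct : {for z, continuous (fun w => tgrad g w ^+ 2)}.
  by apply: continuous_sqr_at; exact: (Ck2_continuous_grad None gC Dz).
have cx : {for z, continuous (fun w => \sum_k xgrad g w k ^+ 2)}.
  apply: continuous_sum_at => k _; apply: continuous_sqr_at.
  exact: (Ck2_continuous_grad (Some k) gC Dz).
have cD (u v : pt R n -> R) : {for z, continuous u} -> {for z, continuous v} ->
    {for z, continuous (fun w => u w + v w)} by move=> ? ?; exact: cvgD.
have cM (u v : pt R n -> R) : {for z, continuous u} -> {for z, continuous v} ->
    {for z, continuous (fun w => u w * v w)} by move=> ? ?; exact: cvgM.
have H := (cD _ _ (cD _ _ (cD _ _ (cM _ _ (cc n.-1%:R) (cD _ _ cg (cc (eps / (n%:R - 1)))))
  (cM _ _ cg (cM _ _ (cc (n.-1%:R - 1)) cx))) (cM _ _ (cc n.-1%:R) ct)) (cD _ _ (cc 1) cx)).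
rewrite /prop_for /continuous_at E (funext E); exact: H.
Qed.

Lemma sqdist_et z (s : R) : sqdist xpredT (z + s *: et) z = s ^+ 2.
Proof.
rewrite /sqdist sum_option big1 ?add0r => [|k _] /=.
  rewrite [s *: _]mulr1; ring.
by rewrite !mxE; ring.
Qed.

Lemma pt_norm_et (s : R) : `|s *: (et : pt R n)| <= `|s|.
Proof.
apply/pt_norm_le => // -[k|] /=; first by rewrite !mxE mulr0 normr0.
by rewrite [s *: _]mulr1.
Qed.

(** Suppose the value at [y], just above [z], is below [K]. On the closed Euclidean ball of radius
    [2 * s] about [y], which has [z] inside, add a multiple of [(C - q w) ^+ N.+2]. The sum exceeds
    [K] at [z], hence at its maximum, which is then neither on the sphere, where the added term
    vanishes, nor near [y], where there is room below [K]. In between, [sqheight_barrier_nomax]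
    forbids it. *)
Lemma vertical_strong_max eps D g c z (K : R) :
  (2 <= n)%N -> 0 <= eps -> open D -> Ck 2 D g ->
  (forall w, D w -> 0 < g w) -> (forall w, D w -> hminop eps g w = 0) ->
  (forall w, D w -> sqheight g c w <= K) -> D z -> sqheight g c z = K ->
  exists2 d : R, 0 < d & forall s, 0 < s < d -> sqheight g c (z + s *: et) = K.
Proof.
move=> n2 eps0 oD gC g0 gM gK Dz zK.
pose La w := minop eps g w (sqnorm xpredT).
have gz2 : 0 < g z / 2 by rewrite divr_gt0 // g0.
have [d1 d10 d1P] := ball_forallI (open_ball oD Dz) (ball_forallI
  (continuous_ball (minop_sqnormT_continuous eps D g z gC Dz) ltr01)
  (continuous_ball (Ck2_continuous gC Dz) gz2)).
pose La0 := `|La z + 1| + 1.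
have La00 : 0 < La0 by rewrite ltr_wpDl.
pose la := Num.min ((g z / 2) ^+ 2) 1.
have la0 : 0 < la by rewrite lt_min ltr01 exprn_gt0.
have near_z w : `|w - z| < d1 -> [/\ D w, La w < La0 & la <= Num.min (g w ^+ 2) 1].
  move=> /d1P[Dw [h1 h2]]; split=> //.
    apply: ltr_pwDr => //.
    have : La w - La z <= 1 by apply: le_trans h1; exact: ler_norm.
    by rewrite lerBlDl => h; apply: le_trans h (ler_norm _).
  rewrite le_min ge_min [X in _ && X]ge_min lexx orbT andbT.
  apply/orP; left; have h : g z / 2 <= g w.
    by move: h2; rewrite ler_norml => /andP[h2 _]; lra.
  by apply: lerXn2r; rewrite ?nnegrE; [exact: ltW | exact: ltW (g0 w Dw) |].
(* Points within [2 * s] of [y] are within [3 * s] of [z]. *)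
exists (d1 / 3); first by rewrite divr_gt0.
move=> s /andP[s0 sd]; set y := z + s *: et.
have s3 : 3 * s < d1 by lra.
have yz : `|y - z| <= s.
  rewrite /y addrC addKr; apply: le_trans (pt_norm_et s) _.
  by rewrite gtr0_norm.
have [Dy _ _] : [/\ D y, La y < La0 & la <= Num.min (g y ^+ 2) 1].
  by apply: near_z; lra.
apply/eqP; rewrite eq_le gK //= leNgt; apply/negP => yK.
pose m := (K - sqheight g c y) / 2.
have m0 : 0 < m by rewrite /m; lra.
have Hcont w : D w -> {for w, continuous (sqheight g c)}.
  by move=> Dw; apply: sqheight_continuous; exact: Ck2_continuous gC Dw.
have [r r0 rP] := continuous_ball (Hcont y Dy) m0.
pose r1 := (r / 2) ^+ 2.
have r10 : 0 < r1 by rewrite exprn_gt0 // divr_gt0.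
pose C := (2 * s) ^+ 2.
have C0 : 0 < C by rewrite exprn_gt0 // mulr_gt0.
pose q := sqdist xpredT y.
have qz : q z = s ^+ 2 by exact: sqdist_et.
(* Large enough for the barrier inequality wherever [r1 < q w < C]: there [(C - q w) * La w] is at
   most [C * La0], and the ellipticity constant times [q w] is at least [la * r1]. *)
pose N := Num.trunc (C * La0 / (2 * (la * r1))).
have NP : C * La0 < 2 * N.+1%:R * (la * r1).
  have := truncnS_gt (C * La0 / (2 * (la * r1))); rewrite -/N.
  by rewrite ltr_pdivrMr ?mulr_gt0 // mulrCA mulrA.
clearbody N.
(* The added term is then at most [m] on the ball, while near [y] the squared height is at most
   [K - m]. *)
pose dl := m / C ^+ N.+2.
have dl0 : 0 < dl by rewrite divr_gt0 // exprn_gt0.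
pose u w := sqheight g c w + dl * (C - q w) ^+ N.+2.
pose S := [set w : pt R n | q w <= C].
have Sball w : S w -> `|w - z| < d1.
  move=> Sw; have h1 : `|w - y| <= 2 * s by apply: sqdistT_le_norm Sw; rewrite mulr_ge0 // ltW.
  have : `|w - z| <= `|w - y| + `|y - z| by rewrite -[w - z](subrKA y) ler_normD.
  lra.
have SD w : S w -> D w by move=> /Sball /near_z[].
have qc : continuous q by exact: sqdist_continuous.
have cS : compact S.
  apply: (@pt_compact _ _ _ (d1 + `|z|)).
    rewrite (_ : S = q @^-1` [set x | x <= C]) //.
    apply: preimage_closed; last exact: closed_le.
    by move=> w _; exact: qc.
  move=> w /Sball h; have : `|w| <= `|w - z| + `|z|.
    by rewrite -{1}[w](subrK z) ler_normD.
  lra.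
have Sz : S z by rewrite /S /= qz /C; nra.
have cu : {within S, continuous u}.
  apply: continuous_in_subspaceT => w; rewrite inE => /SD Dw.
  apply: cvgD; first exact: Hcont.
  apply: cvgM; first exact: cvg_cst.
  apply: continuousX_at; apply: cvgB; [exact: cvg_cst | exact: qc].
have [z1] := compact_EVT_max (ex_intro _ z Sz) cS cu.
rewrite inE => Sz1 z1max.
have Dz1 := SD _ Sz1.
have uz1 : K < u z1.
  apply: lt_le_trans (z1max z _); last by rewrite inE.
  rewrite /u zK ltrDl mulr_gt0 // exprn_gt0 // qz /C; nra.
have qz1C : q z1 < C.
  rewrite lt_neqAle Sz1 andbT; apply/eqP => E.
  by move: uz1; rewrite /u E subrr expr0n mulr0 addr0 ltNge gK.
have qz1r : r1 < q z1.
  rewrite ltNge; apply/negP => h.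
  have : `|z1 - y| < r.
    have : `|z1 - y| <= r / 2 by apply: sqdistT_le_norm h; rewrite divr_ge0 // ltW.
    lra.
  move=> /rP; rewrite ler_norml => /andP[_ h2].
  have : dl * (C - q z1) ^+ N.+2 <= m.
    rewrite /dl mulrAC ler_pdivrMr; last exact: exprn_gt0.
    apply: ler_wpM2l; first exact: ltW.
    apply: lerXn2r; rewrite ?nnegrE ?subr_ge0 //; first exact: ltW.
    by rewrite gerBl sqdist_ge0.
  by move: uz1 h2; rewrite /u /m; move: (dl * _) => X; lra.
have [_ Lz1 lz1] := near_z _ (Sball _ Sz1).
have [||||||||||] := @sqheight_barrier_nomax R n eps D g c y z1 dl C N => //.
- exact: g0.
- exact: gM.
- by rewrite subr_gt0.
- rewrite -/(La z1) -/(q z1).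
  apply: (@le_lt_trans _ _ (C * La0)).
    apply: (@le_trans _ _ ((C - q z1) * La0)).
      by rewrite ler_wpM2l ?subr_ge0 // ltW.
    apply: ler_wpM2r; first exact: ltW.
    by rewrite gerBl sqdist_ge0.
  apply: lt_le_trans NP _; rewrite ler_wpM2l ?mulr_ge0 //.
  by apply: ler_pM => //; exact: ltW.
- have [e e0 eP] : ball_forall z1 S.
    have e0 : 0 < C - q z1 by rewrite subr_gt0.
    apply: ball_forallS (continuous_ball (qc z1) e0) => w /(le_trans (ler_norm _)).
    by rewrite /S /= lerD2r.
  by exists e => // w /eP Sw; apply: z1max; rewrite inE.
Qed.

End StrongMaximumPrinciple.

(** * Bounded open sets and their boundary *)

Section BoundedDomain.
Context {R : realType} {n : nat}.
Implicit Types (Om : set (pt R n)) (g u : pt R n -> R) (z c : pt R n).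

Lemma closure_compact Om : bounded_set Om -> compact (closure Om).
Proof.
move=> [M [_ hM]]; apply: (@pt_compact _ _ _ (M + 1)); first exact: closed_closure.
have cS : closed [set z : pt R n | `|z| <= M + 1].
  apply: (@preimage_closed _ _ (fun z : pt R n => `|z|) [set x | x <= M + 1]).
    by move=> z _; exact: norm_continuous.
  exact: closed_le.
move=> z; rewrite closureE => /(_ [set z | `|z| <= M + 1]); apply; split=> //.
by move=> w Omw; apply: hM => //; rewrite ltrDl.
Qed.

Lemma closure_closed_le Om u (K : R) : continuous u ->
  (forall z, Om z -> u z <= K) -> forall z, closure Om z -> u z <= K.
Proof.
move=> uc uK z; rewrite closureE => /(_ [set z | u z <= K]); apply; split => //.
apply: (@preimage_closed _ _ u [set x | x <= K]); last exact: closed_le.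
by move=> w _; exact: uc.
Qed.

Lemma bdryP Om z : open Om -> closure Om z -> ~ Om z -> bdry Om z.
Proof. by move=> oO cz nz; split=> //; move/interior_subset. Qed.

Lemma bdry_closure Om z : bdry Om z -> closure Om z.
Proof. by case. Qed.

Lemma bdry_closed Om : closed (bdry Om).
Proof.
rewrite /bdry setDE; apply: closedI; first exact: closed_closure.
by apply: open_closedC; exact: open_interior.
Qed.

Lemma sqdist_isSome_eq c z w : z.1 = w.1 ->
  sqdist isSome c z = sqdist isSome c w.
Proof. by rewrite /sqdist !sum_isSome /= => ->. Qed.

Lemma sqdist_isSome_le0 c z : (sqdist isSome c z <= 0) <-> z.1 = c.1.
Proof.
rewrite /sqdist sum_isSome /=; split=> [h|->]; last first.
  by rewrite big1 // => k _; rewrite subrr expr0n.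
have : \sum_k (z.1 0 k - c.1 0 k) ^+ 2 == 0.
  by rewrite eq_le h sumr_ge0 // => k _; exact: sqr_ge0.
rewrite psumr_eq0 => [/allP h0|k _]; last exact: sqr_ge0.
apply/rowP => k; have := h0 k; rewrite mem_index_enum => /(_ isT).
by rewrite sqrf_eq0 subr_eq0 => /eqP.
Qed.

(* [b] is the highest point of the level set {u = K} on the vertical line
   through [z]. *)
Lemma vertical_climb Om u (K : R) z : open Om -> bounded_set Om ->
  {within closure Om, continuous u} ->
  (forall w, Om w -> u w = K ->
     exists2 d : R, 0 < d & forall s, 0 < s < d -> u (w + s *: et) = K) ->
  Om z -> u z = K ->
  exists b, [/\ bdry Om b, b.1 = z.1 & u b = K].
Proof.
move=> oO bO uc step Oz uz.
(* The vertical line through [z] is written as [sqdist isSome z w <= 0], a closed condition by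
   continuity. *)
pose S := closure Om `&` u @^-1` [set K] `&` [set w | sqdist isSome z w <= 0].
have cS : closed S.
  apply: closedI.
    rewrite closed_setSI; last exact: closed_closure.
    by apply: closed_comp; [move=> w _; exact: uc | exact: closed_eq].
  apply: (@preimage_closed _ _ (sqdist isSome z) [set x | x <= 0]).
    by move=> w _; exact: sqdist_continuous.
  exact: closed_le.
have kS : compact S.
  by apply: (subclosed_compact cS (closure_compact Om bO)) => w [[]].
have sqx w := sqdist_isSome_le0 z w.
have Sz : S z by split; [split=> //; exact: subset_closure | exact/sqx].
have tc : {within S, continuous (fun w : pt R n => co w None)}.
  by apply: continuous_subspaceT; exact: co_continuous.
have [b] := compact_EVT_max (ex_intro _ z Sz) kS tc.
rewrite inE => -[[cb ub] /sqx bz] bmax.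
exists b; split=> //; apply: bdryP => // Ob.
have [d d0 dP] := step b Ob ub.
have [e e0 eP] := open_ball oO Ob.
pose s := Num.min d e / 2.
have m0 : 0 < Num.min d e by rewrite lt_min d0.
have s0 : 0 < s by rewrite divr_gt0.
have : s < Num.min d e by rewrite /s; lra.
rewrite lt_min => /andP[sd se].
(* If [b] were in [Om], it would have a higher point of [S] above it. *)
have Sb : S (b + s *: et).
  split; last by apply/sqx; rewrite /= scaler0 addr0.
  split; last by apply: dP; rewrite s0.
  apply: subset_closure; apply: eP; rewrite addrC addKr.
  by apply: le_lt_trans (pt_norm_et s) _; rewrite gtr0_norm.
have := bmax (b + s *: et); rewrite inE => /(_ Sb) /=.
by rewrite [s *: _]mulr1 gerDl leNgt s0.
Qed.

(** A constant function stays on its level set along the whole vertical line, so [vertical_climb]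
    applies with any step. *)
Lemma bdry_above Om z : open Om -> bounded_set Om -> Om z ->
  exists2 b, bdry Om b & b.1 = z.1.
Proof.
move=> oO bO Oz.
have [||b [? ? _]] := @vertical_climb Om (fun=> 0) 0 z oO bO _ _ Oz erefl.
- by apply: continuous_subspaceT => w; exact: cvg_cst.
- by move=> w _ _; exists 1.
- by exists b.
Qed.

End BoundedDomain.

(** * Height estimates with an arbitrary centre *)

Section HeightEstimates.
Context {R : realType} {n : nat}.
Implicit Types (Om : set (pt R n)) (g : pt R n -> R) (z c : pt R n).

(** A maximum over the compact closure lies on the boundary or, by [vertical_strong_max], recurs at
    a boundary point on its vertical line. The equality clause keeps that point, for the strict
    inequality later. *)
Lemma sqheight_max eps Om g c (K : R) :
  (2 <= n)%N -> 0 <= eps -> open Om -> bounded_set Om -> Ck 2 Om g ->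
  {within closure Om, continuous g} -> (forall w, Om w -> 0 < g w) ->
  (forall w, Om w -> hminop eps g w = 0) ->
  (forall b, bdry Om b -> sqheight g c b <= K) ->
  forall z, Om z -> sqheight g c z <= K /\
    (sqheight g c z = K ->
      exists b, [/\ bdry Om b, b.1 = z.1 & sqheight g c b = K]).
Proof.
move=> n2 eps0 oO bO gC gc g0 gM bK.
have hc : {within closure Om, continuous (sqheight g c)}.
  have dc : {within closure Om, continuous (sqdist isSome c)}.
    by apply: continuous_subspaceT; exact: sqdist_continuous.
  by move=> w; apply: cvgD (dc w); exact: (cvgM (gc w) (gc w)).
have climb w L : (forall v, Om v -> sqheight g c v <= L) -> Om w ->
    sqheight g c w = L ->
    exists b, [/\ bdry Om b, b.1 = w.1 & sqheight g c b = L].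
  move=> hL Ow wL; apply: (vertical_climb Om _ _ _ oO bO hc) => // v Ov vL.
  exact: (vertical_strong_max eps Om).
move=> z Oz.
have cz : closure Om z by exact: subset_closure.
have [z1] := compact_EVT_max (ex_intro _ z cz) (closure_compact Om bO) hc.
rewrite inE => cz1 z1max.
have z1m w : Om w -> sqheight g c w <= sqheight g c z1.
  by move=> Ow; apply: z1max; rewrite inE; exact: subset_closure.
have z1K : sqheight g c z1 <= K.
  have [Oz1|nOz1] := pselect (Om z1); last by apply: bK; exact: bdryP.
  by have [b [/bK bb _ <-]] := climb z1 _ z1m Oz1 erefl.
have hK w : Om w -> sqheight g c w <= K by move=> /z1m h; exact: le_trans h z1K.
by split=> [|zK]; [exact: hK | exact: climb].
Qed.

(** If [g z ^+ 2] reached the bound, [z] would lie over [c], and a boundary point over [z] would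
    satisfy [g b ^+ 2 = F + H ^+ 2 <= F], so [H ^+ 2 = 0]. The boundary, and with it [Om] by
    [bdry_above], would lie on one vertical line. *)
Lemma lt_sqheight_bound eps Om g c (F H : R) :
  (2 <= n)%N -> 0 <= eps -> open Om -> bounded_set Om -> Ck 2 Om g ->
  {within closure Om, continuous g} -> (forall w, Om w -> 0 < g w) ->
  (forall w, Om w -> hminop eps g w = 0) ->
  (forall b, bdry Om b -> g b ^+ 2 <= F) ->
  (forall b, bdry Om b -> sqdist isSome c b <= H ^+ 2) ->
  forall z, Om z -> sqheight g c z <= F + H ^+ 2 /\ g z ^+ 2 < F + H ^+ 2.
Proof.
move=> n2 eps0 oO bO gC gc g0 gM bF bH z Oz.
have bK b : bdry Om b -> sqheight g c b <= F + H ^+ 2.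
  by move=> Gb; apply: lerD; [exact: bF | exact: bH].
have [hz hz'] := sqheight_max eps Om g c _ n2 eps0 oO bO gC gc g0 gM bK z Oz.
split=> //; rewrite ltNge; apply/negP => zK.
have d0 := sqdist_ge0 isSome c z.
have dz : sqdist isSome c z = 0 by move: hz; rewrite /sqheight; lra.
have [|b [Gb bz]] := hz'; first by apply/eqP; rewrite eq_le hz /sqheight dz addr0.
rewrite /sqheight (sqdist_isSome_eq _ _ _ bz) dz addr0 => gb.
have H0 : H ^+ 2 <= 0 by have := bF b Gb; lra.
have bc b' : bdry Om b' -> b'.1 = c.1.
  by move=> Gb'; apply/sqdist_isSome_le0; exact: le_trans (bH b' Gb') H0.
have Oc w : Om w -> w.1 = c.1.
  by move=> Ow; have [b' Gb' <-] := bdry_above Om w oO bO Ow; exact: bc.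
(* As [n] is at least 2 there is a horizontal direction, along which the open set contains a second
   point. *)
have n1 : (0 < n.-1)%N by case: (n) n2 => [|[|]].
have [e e0 eP] := open_ball oO Oz.
pose v : pt R n := ex (Ordinal n1).
have v0 : 0 < `|v| + 1 by rewrite ltr_wpDl.
pose s := e / (`|v| + 1).
have s0 : 0 < s by rewrite divr_gt0.
have Ov : Om (z + s *: v).
  apply: eP; rewrite addrC addKr normrZ gtr0_norm // /s mulrAC ltr_pdivrMr //.
  by rewrite ltr_pM2l // ltrDl.
have := congr1 (fun x : 'rV[R]_n.-1 => x 0 (Ordinal n1)) (Oc _ Ov).
rewrite -(Oc _ Oz) !mxE !eqxx mulr1 => /eqP.
by rewrite -subr_eq0 addrAC subrr add0r gt_eqF.
Qed.

Lemma no_interior_min eps Om g z :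
  (2 <= n)%N -> 0 <= eps -> open Om -> Ck 2 Om g -> Om z -> 0 < g z ->
  hminop eps g z = 0 -> ~ (forall w, Om w -> g z <= g w).
Proof.
move=> n2 eps0 oO gC Oz gz gM gmin.
have n10 : 0 < n%:R - 1 :> R by rewrite subr_gt0 ltr1n.
have crit i : 'D_(axis i) g z = 0 /\ 0 <= hess g z i i.
  (* The expansion of [- g], for which [z] is a maximum. *)
  have T := taylor2M (taylor2_poly (- 1) 0 0) (Ck2_taylor2 1 0 i i oO gC Oz).
  have [|] := taylor2_max T.
    have [e e0 eP] := open_ball oO Oz.
    pose v : pt R n := 1 *: axis i + 0 *: axis i.
    have v0 : 0 < `|v| + 1 by rewrite ltr_wpDl.
    apply/nbhs_ballP; exists (e / (`|v| + 1)); first exact: divr_gt0.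
    move=> s; rewrite /ball /= sub0r normrN ltr_pdivlMr // => se.
    have Ov : Om (z + s *: v).
      apply: eP; rewrite addrC addKr normrZ; apply: le_lt_trans se.
      by rewrite ler_wpM2l // lerDl.
    have := gmin _ Ov; rewrite -/v; move: (g (z + _)) (g z) => x y; lra.
  move: ('D_(axis i) g z) (hess g z i i) (g z) => x h y; split; lra.
have p0 : xgrad g z = fun=> 0 by apply/funext => k; have [] := crit (Some k).
have t0 : tgrad g z = 0 by have [] := crit None.
(* With zero gradient every direction in [ellop] has second coefficient 0, so pure second
   derivatives suffice. *)
have q0 al i j : 0 <= qform (hess g z) al i 0 j.
  have -> : qform (hess g z) al i 0 j = al ^+ 2 * hess g z i i / 2.
    by rewrite /qform; move: (hess g z) => h; ring.
  by rewrite divr_ge0 // mulr_ge0 ?sqr_ge0 //; have [] := crit i.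
have m0 : 0 <= minop eps g z (qform (hess g z)).
  rewrite /minop p0 t0 /ellop !addr_ge0 //.
  - apply: sumr_ge0 => k _; rewrite mulr_ge0 ?addr_ge0 ?sqr_ge0 //.
    by rewrite divr_ge0 // ltW.
  - rewrite mulr_ge0 ?sqr_ge0 // sumr_ge0 // => k _; rewrite sumr_ge0 // => j _.
    by rewrite oppr0; exact: q0.
  - by apply: sumr_ge0 => k _; exact: q0.
have := gM; rewrite hminopE p0 t0 big1 => [|k _]; last by rewrite expr0n.
rewrite expr0n mul0r mulr0 !addr0 mulr1.
by have := mulr_gt0 n10 gz; move: m0; move: (minop _ _ _ _) => X; lra.
Qed.

(** The minimum over the closure is not interior; and if [g z] did not exceed it, [z] itself would
    be an interior minimum. *)
Lemma exists_bdry_lt eps Om g :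
  (2 <= n)%N -> 0 <= eps -> open Om -> bounded_set Om -> Ck 2 Om g ->
  {within closure Om, continuous g} -> (forall w, Om w -> 0 < g w) ->
  (forall w, Om w -> hminop eps g w = 0) ->
  forall z, Om z -> exists2 b, bdry Om b & g b < g z.
Proof.
move=> n2 eps0 oO bO gC gc g0 gM z Oz.
have nomin w : Om w -> ~ (forall v, Om v -> g w <= g v).
  by move=> Ow; apply: (no_interior_min eps Om) => //; [exact: g0 | exact: gM].
have cz : closure Om z by exact: subset_closure.
have [z1] := compact_EVT_min (ex_intro _ z cz) (closure_compact Om bO) gc.
rewrite inE => cz1 z1min.
have z1m w : Om w -> g z1 <= g w.
  by move=> Ow; apply: z1min; rewrite inE; exact: subset_closure.
exists z1; first by apply: bdryP => // Oz1; exact: nomin Oz1 z1m.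
rewrite ltNge; apply/negP => h; apply: (nomin z Oz) => w Ow.
exact: le_trans h (z1m w Ow).
Qed.

End HeightEstimates.

(** * The radius of the smallest disk *)

Section DiskRadius.
Context {R : realType} {n : nat}.
Implicit Types (Om : set (pt R n)) (g : pt R n -> R) (z c : pt R n).

Lemma edist_sqdist z c : Defs.edist z.1 c.1 ^+ 2 = sqdist isSome c z.
Proof.
rewrite /Defs.edist sqr_sqrtr ?sumr_ge0 // => [|k _]; last exact: sqr_ge0.
by rewrite /sqdist sum_isSome.
Qed.

(* Young's inequality replaces the triangle inequality. *)
Lemma sqdist_young P c z w (t : R) : 0 < t ->
  sqdist P z w <= (1 + t) * sqdist P c w + (1 + t^-1) * sqdist P c z.
Proof.
move=> t0; rewrite /sqdist !mulr_sumr -big_split /=; apply: ler_sum => l _.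
move: (co w l) (co z l) (co c l) => x y a.
rewrite -subr_ge0.
have -> : (1 + t) * (x - a) ^+ 2 + (1 + t^-1) * (y - a) ^+ 2 - (x - y) ^+ 2
  = t^-1 * (t * (x - a) + (y - a)) ^+ 2 by field; exact: lt0r_neq0.
by rewrite mulr_ge0 ?sqr_ge0 // ltW // invr_gt0.
Qed.

(** The infimum need not be attained, so an optimal centre is drawn from the assumed failure at [z]:
    for a disk of centre [c] and radius [rc], the height bound gives
    [sqdist isSome c z <= rc ^+ 2 - r ^+ 2]. As [rc] tends to [r], the centres approach the
    projection of [z], so the disk of radius [r] about it contains the whole projection, and
    [lt_sqheight_bound] with centre [z] contradicts the failure. *)
Lemma lt_disk_radius_bound eps Om g (F : R) :
  (2 <= n)%N -> 0 <= eps -> open Om -> bounded_set Om -> Ck 2 Om g ->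
  {within closure Om, continuous g} -> (forall w, Om w -> 0 < g w) ->
  (forall w, Om w -> hminop eps g w = 0) ->
  (forall b, bdry Om b -> g b ^+ 2 <= F) ->
  forall z, Om z -> g z ^+ 2 < F + disk_radius (fst @` Om) ^+ 2.
Proof.
move=> n2 eps0 oO bO gC gc g0 gM bF z Oz.
set A := [set r : R | exists2 c, (fst @` Om) c &
  forall x, (fst @` Om) x -> Defs.edist x c <= r].
pose r := inf A; rewrite -[disk_radius _]/r.
have lbA : lbound A 0.
  by move=> x [c [w Ow <-]] /(_ w.1) h; apply: le_trans (h _); [exact: sqrtr_ge0 | exists w].
have Aneq : A !=set0.
  have dc : {within closure Om, continuous (sqdist isSome z)}.
    by apply: continuous_subspaceT; exact: sqdist_continuous.
  have cz : closure Om z by exact: subset_closure.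
  have [w _ wmax] := compact_EVT_max (ex_intro _ z cz) (closure_compact Om bO) dc.
  exists (Num.sqrt (sqdist isSome z w)), z.1; first by exists z.
  move=> _ [v Ov <-]; rewrite -[Defs.edist _ _]ger0_norm ?sqrtr_ge0 // -sqrtr_sqr.
  rewrite edist_sqdist ler_wsqrtr //; apply: wmax; rewrite inE.
  exact: subset_closure.
have r0 : 0 <= r by exact: lb_le_inf.
have infA : has_inf A by split=> //; exists 0.
rewrite ltNge; apply/negP => zr.
have close rc : A rc -> r <= rc /\ forall t w, 0 < t -> Om w ->
    sqdist isSome z w <= (1 + t) * rc ^+ 2 + (1 + t^-1) * (rc ^+ 2 - r ^+ 2).
  move=> Arc; have rrc : r <= rc by apply: ge_inf => //; exists 0.
  split=> // t w t0 Ow; case: Arc => _ [c Oc <-] hc.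
  have cle v : Om v -> sqdist isSome c v <= rc ^+ 2.
    move=> Ov; rewrite -edist_sqdist; apply: lerXn2r; rewrite ?nnegrE ?sqrtr_ge0 //.
      exact: le_trans rrc.
    by apply: hc; exists v.
  have cb b : bdry Om b -> sqdist isSome c b <= rc ^+ 2.
    move=> /bdry_closure.
    exact: (closure_closed_le Om _ _ (sqdist_continuous isSome c) cle).
  have [hz _] := lt_sqheight_bound eps Om g c F rc n2 eps0 oO bO gC gc g0 gM bF cb z Oz.
  apply: le_trans (sqdist_young _ c z w t t0) _; apply: lerD.
    by apply: ler_wpM2l; [rewrite addr_ge0 // ltW | exact: cle].
  apply: ler_wpM2l; first by rewrite addr_ge0 // ltW // invr_gt0.
  by move: hz; rewrite /sqheight; lra.
have zdisk w : Om w -> sqdist isSome z w <= r ^+ 2.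
  move=> Ow; apply/ler_addgt0Pr => e e0.
  (* The bound from [close] equals [(1 + t) * r ^+ 2 + (2 + t + t^-1) * (rc ^+ 2 - r ^+ 2)]. The
     choice of [t] makes [t * r ^+ 2] at most [e / 2]; then [de] does the same for the last term, as
     [rc ^+ 2 - r ^+ 2 <= de * (2 * r + 1)]. *)
  pose t := e / (2 * (r ^+ 2 + 1)).
  have r21 : 0 < r ^+ 2 + 1 by rewrite ltr_wpDl // sqr_ge0.
  have t0 : 0 < t by rewrite divr_gt0 // mulr_gt0.
  have tr : t * r ^+ 2 <= e / 2.
    rewrite /t mulrAC ler_pdivrMr ?mulr_gt0 //; nra.
  pose M := (2 + t + t^-1) * (2 * r + 1).
  have ti0 : 0 < t^-1 by rewrite invr_gt0.
  have M0 : 0 < M by apply: mulr_gt0; lra.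
  pose de := Num.min 1 (e / 2 / M).
  have de0 : 0 < de by rewrite lt_min ltr01 !divr_gt0.
  have [rc Arc rcde] := inf_adherent de0 infA.
  have [rrc /(_ t w t0 Ow) h] := close rc Arc.
  apply: le_trans h _.
  have d1 : de <= 1 by rewrite ge_min lexx.
  have dM : de * M <= e / 2 by rewrite -ler_pdivlMr // ge_min lexx orbT.
  have D0 : rc ^+ 2 - r ^+ 2 <= de * (2 * r + 1).
    have : rc - r <= de by rewrite /r; lra.
    nra.
  have : (2 + t + t^-1) * (rc ^+ 2 - r ^+ 2) <= de * M.
    rewrite /M mulrCA; apply: ler_wpM2l => //.
    by rewrite ltW // !addr_gt0.
  move: tr dM; nra.
have cb b : bdry Om b -> sqdist isSome z b <= r ^+ 2.
  move=> /bdry_closure.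
  exact: (closure_closed_le Om _ _ (sqdist_continuous isSome z) zdisk).
have [_] := lt_sqheight_bound eps Om g z F r n2 eps0 oO bO gC gc g0 gM bF cb z Oz.
by rewrite ltNge zr.
Qed.

End DiskRadius.

(** * The case n = 2 and the final bounds *)

Lemma lt_xwidth_bound (R : realType) (eps : R) (Om : set (pt R 2))
    (g : pt R 2 -> R) (F : R) :
  0 <= eps -> open Om -> bounded_set Om -> Ck 2 Om g ->
  {within closure Om, continuous g} -> (forall w, Om w -> 0 < g w) ->
  (forall w, Om w -> hminop eps g w = 0) ->
  (forall b, bdry Om b -> g b ^+ 2 <= F) ->
  forall z, Om z -> g z ^+ 2 < F + (xwidth (bdry Om) / 2) ^+ 2.
Proof.
move=> eps0 oO bO gC gc g0 gM bF z Oz.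
set G := [set w.1 0 0 | w in bdry Om].
(* The midpoint of the range of x on the boundary, which is within half the width of every boundary
   point horizontally. *)
pose c : pt R 2 := (\row_(k < 1) ((sup G + inf G) / 2), 0).
have [b0 Gb0 _] := bdry_above Om z oO bO Oz.
have bc : compact (bdry Om).
  apply: (subclosed_compact (bdry_closed Om) (closure_compact Om bO)).
  exact: bdry_closure.
have xc : {within bdry Om, continuous (fun w : pt R 2 => co w (Some 0))}.
  by apply: continuous_subspaceT; exact: co_continuous.
have [b1 _ b1P] := compact_EVT_max (ex_intro _ b0 Gb0) bc xc.
have [b2 _ b2P] := compact_EVT_min (ex_intro _ b0 Gb0) bc xc.
have ubG : has_ubound G.
  by exists (co b1 (Some 0)) => _ [b Gb <-]; apply: b1P; rewrite inE.
have lbG : has_lbound G.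
  by exists (co b2 (Some 0)) => _ [b Gb <-]; apply: b2P; rewrite inE.
have cb b : bdry Om b -> sqdist isSome c b <= (xwidth (bdry Om) / 2) ^+ 2.
  move=> Gb; rewrite /sqdist sum_isSome big_ord1 /= mxE /xwidth -/G.
  have h1 : b.1 0 0 <= sup G by apply: ub_le_sup => //; exists b.
  have h2 : inf G <= b.1 0 0 by apply: ge_inf => //; exists b.
  move: h1 h2; rewrite (ord1 ord0); move: (b.1 0 0) (sup G) (inf G) => x s i.
  by nra.
by have [] := lt_sqheight_bound eps Om g c F _ isT eps0 oO bO gC gc g0 gM bF cb z Oz.
Qed.

Theorem lemma3p1 (R : realType) (n : nat) (eps : R)
    (Om : set (pt R n)) (f g : pt R n -> R) :
  (2 <= n)%N ->
  0 <= eps <= 1 ->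
  bounded_C0_domain Om ->
  {within bdry Om, continuous f} ->
  (forall z, bdry Om z -> 0 < f z) ->
  Ck 2 Om g ->
  {within closure Om, continuous g} ->
  (forall z, closure Om z -> 0 < g z) ->
  (forall z, bdry Om z -> g z = f z) ->
  (forall z, Om z -> hminop eps g z = 0) ->
  forall z, Om z -> inf (f @` bdry Om) < g z /\ g z < Rbound Om f.
Proof.
move=> n2 /andP[eps0 _] [oO _ _ bO _] fc f0 gC gc g0' gf gM z Oz.
have g0 w : Om w -> 0 < g w by move=> Ow; apply: g0'; exact: subset_closure.
split.
  have [b Gb] := exists_bdry_lt eps Om g n2 eps0 oO bO gC gc g0 gM z Oz.
  apply: le_lt_trans; rewrite gf //; apply: ge_inf; last by exists b.
  by exists 0 => _ [w Gw <-]; apply: ltW; exact: f0.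
set F := sup [set f w ^+ 2 | w in bdry Om].
have [b0 Gb0 _] := bdry_above Om z oO bO Oz.
have bF b : bdry Om b -> g b ^+ 2 <= F.
  move=> Gb; rewrite gf //; apply: ub_le_sup; last by exists b.
  have bc : compact (bdry Om).
    apply: (subclosed_compact (bdry_closed Om) (closure_compact Om bO)).
    exact: bdry_closure.
  have [b1 _ b1P] := compact_EVT_max (ex_intro _ b0 Gb0) bc fc.
  exists (f b1 ^+ 2) => _ [w Gw <-].
  have fw : f w <= f b1 by apply: b1P; rewrite inE.
  have fw0 := ltW (f0 w Gw).
  by apply: lerXn2r => //; rewrite nnegrE //; exact: le_trans fw.
(* Both sides are nonnegative, so squares can be compared. *)
suff zR : g z ^+ 2 < F + hradius Om ^+ 2.
  rewrite -[g z]ger0_norm ?(ltW (g0 z Oz)) // -sqrtr_sqr ltr_sqrt //.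
  by apply: le_lt_trans zR; exact: sqr_ge0.
(* [hradius] reduces only on an explicit dimension: 2 selects the width, [m.+3] the disk radius. *)
case: n n2 Om f g oO bO fc f0 gC gc g0' gf gM z Oz g0 F b0 Gb0 bF => [|[|[|m]]] //.
  move=> _ Om f g oO bO fc f0 gC gc g0' gf gM z Oz g0 F b0 Gb0 bF.
  exact: (lt_xwidth_bound R eps Om).
move=> n2 Om f g oO bO fc f0 gC gc g0' gf gM z Oz g0 F b0 Gb0 bF.
exact: (lt_disk_radius_bound eps Om).
Qed.
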